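(* Let $(F,\theta)$ be an iterative differential field with field of constants $C$. Assume that $\theta^{(1)}\neq 0$, and let $t\in F$ with $\theta^{(1)}(t)\neq 0$. Define a continuous isomorphism of $F$-algebras $\mu:F[[T]]\to F[[T]]$ by $\mu(T)=\theta(t)-t$, and let $\lambda:=\mu^{-1}$. Then the homomorphism $\tilde{\theta}:=\lambda\circ\theta:F\to F[[T]]$ is an iterative derivation on $F$, and $\tilde{\theta}$ extends the iterative derivation by $t$ on $C(t)$, i.e. $\tilde{\theta}(t)=t+T$.
   Context: An iterative derivation on a ring $R$ is a ring homomorphism $\theta:R\to R[[T]]$, $\theta(r)=\sum_{i\ge 0}\theta^{(i)}(r)T^i$, with $\theta^{(0)}=\mathrm{id}_R$ and $\theta^{(i)}\circ\theta^{(j)}=\binom{i+j}{i}\theta^{(i+j)}$ for all $i,j\ge 0$. An iterative differential field is a field with an iterative derivation; its field of constants is $\{r\mid\theta^{(i)}(r)=0\ \forall i\ge 1\}$. Power series rings carry the $\mathfrak{m}$-adic topology, $\mathfrak{m}$ being the ideal generated by the variables; a continuous $F$-algebra homomorphism $F[[T]]\to F[[T]]$ is determined by the image of $T$. The iterative derivation by $t$ on $C(t)$ is the iterative derivation $\theta_t$ given by $C$-linear maps $\theta_t^{(n)}$ determined by $\theta_t^{(n)}(t^k)=\binom{k}{n}t^{k-n}$ for all $k,n\in\mathbb{N}$. *)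

(* Defs.v *)
From HB Require Import structures.
From mathcomp Require Import all_boot all_order all_algebra.
From mathcomp Require Import boolp classical_sets filter topology_structure.

Set Implicit Arguments.
Unset Strict Implicit.
Unset Printing Implicit Defensive.

Import GRing.Theory.
Local Open Scope ring_scope.

(* Wrapping [nat -> R] in a record keeps the Cauchy product and the T-adic
   topology apart from the pointwise structures on function types. *)
Record fps (R : Type) := Fps { fpscoef : nat -> R }.

Notation "{ 'fps' R }" := (fps R) (format "{ 'fps'  R }") : type_scope.

HB.instance Definition _ (R : Type) := gen_eqMixin {fps R}.
HB.instance Definition _ (R : Type) := gen_choiceMixin {fps R}.

Lemma fpsP (R : Type) (f g : {fps R}) :
  (forall n, fpscoef f n = fpscoef g n) -> f = g.
Proof. by case: f g => [f] [g] /= /funext->. Qed.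

Section FpsRing.
Variable R : comNzRingType.
Implicit Types (f g h : {fps R}) (a : R).

Definition fps0 : {fps R} := Fps (fun=> 0).
Definition fps_opp f : {fps R} := Fps (fun n => - fpscoef f n).
Definition fps_add f g : {fps R} := Fps (fun n => fpscoef f n + fpscoef g n).
Definition fps1 : {fps R} := Fps (fun n => (n == 0%N)%:R).
Definition fps_mul f g : {fps R} :=
  Fps (fun n => \sum_(i < n.+1) fpscoef f i * fpscoef g (n - i)%N).
Definition fps_scale a f : {fps R} := Fps (fun n => a * fpscoef f n).

Fact fps_addA : associative fps_add.
Proof. by move=> f g h; apply: fpsP => n /=; rewrite addrA. Qed.
Fact fps_addC : commutative fps_add.
Proof. by move=> f g; apply: fpsP => n /=; rewrite addrC. Qed.
Fact fps_add0 : left_id fps0 fps_add.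
Proof. by move=> f; apply: fpsP => n /=; rewrite add0r. Qed.
Fact fps_addN : left_inverse fps0 fps_opp fps_add.
Proof. by move=> f; apply: fpsP => n /=; rewrite addNr. Qed.

HB.instance Definition _ := GRing.isZmodule.Build {fps R}
  fps_addA fps_addC fps_add0 fps_addN.

Let trunc n f : {poly R} := \poly_(i < n) fpscoef f i.

Let trunc_coef n f i : (i < n)%N -> (trunc n f)`_i = fpscoef f i.
Proof. by rewrite coef_poly => ->. Qed.

Let mul_trunc n f g i : (i < n)%N ->
  fpscoef (fps_mul f g) i = (trunc n f * trunc n g)`_i.
Proof.
move=> lt_in; rewrite coefM; apply: eq_bigr => j _.
have le_ji : (j <= i)%N by rewrite -ltnS.
by rewrite !trunc_coef ?(leq_ltn_trans _ lt_in) ?leq_subr.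
Qed.

Fact fps_mulC : commutative fps_mul.
Proof. by move=> f g; apply: fpsP => n; rewrite !(@mul_trunc n.+1) // mulrC. Qed.

Fact fps_mulA : associative fps_mul.
Proof.
move=> f g h; apply: fpsP => n; pose t := trunc n.+1.
transitivity ((t f * (t g * t h))`_n).
  rewrite coefM /=; apply: eq_bigr => j _.
  rewrite trunc_coef ?ltn_ord //; congr (_ * _).
  by rewrite -(@mul_trunc n.+1) // ltnS leq_subr.
rewrite mulrA coefM /=; apply: eq_bigr => j _.
rewrite [(t h)`__]trunc_coef ?ltnS ?leq_subr //; congr (_ * _).
by rewrite -(@mul_trunc n.+1) // ltn_ord.
Qed.

Fact fps_mul1 : left_id fps1 fps_mul.
Proof.
move=> f; apply: fpsP => n /=; rewrite big_ord_recl subn0 mul1r big1 ?addr0 //.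
by move=> i _; rewrite mul0r.
Qed.

Fact fps_mulDl : left_distributive fps_mul +%R.
Proof.
move=> f g h; apply: fpsP => n /=; rewrite -big_split.
by apply: eq_bigr => i _; rewrite mulrDl.
Qed.

Fact fps1_neq0 : fps1 != 0.
Proof.
by apply/eqP => /(congr1 (@fpscoef R ^~ 0%N)) /= /eqP; rewrite oner_eq0.
Qed.

HB.instance Definition _ := GRing.Zmodule_isComNzRing.Build {fps R}
  fps_mulA fps_mulC fps_mul1 fps_mulDl fps1_neq0.

Fact fps_scaleA a b f : fps_scale a (fps_scale b f) = fps_scale (a * b) f.
Proof. by apply: fpsP => n /=; rewrite mulrA. Qed.
Fact fps_scale1 : left_id 1 fps_scale.
Proof. by move=> f; apply: fpsP => n /=; rewrite mul1r. Qed.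
Fact fps_scaleDr : right_distributive fps_scale +%R.
Proof. by move=> a f g; apply: fpsP => n /=; rewrite mulrDr. Qed.
Fact fps_scaleDl f : {morph fps_scale^~ f : a b / a + b}.
Proof. by move=> a b; apply: fpsP => n /=; rewrite mulrDl. Qed.

HB.instance Definition _ := GRing.Zmodule_isLmodule.Build R {fps R}
  fps_scaleA fps_scale1 fps_scaleDr fps_scaleDl.

Fact fps_scaleAl a f g : a *: (f * g) = (a *: f) * g.
Proof.
apply: fpsP => n /=; rewrite mulr_sumr.
by apply: eq_bigr => i _; rewrite mulrA.
Qed.

HB.instance Definition _ := GRing.Lmodule_isLalgebra.Build R {fps R}
  fps_scaleAl.
HB.instance Definition _ := GRing.Lalgebra_isComAlgebra.Build R {fps R}.

Definition fpsT : {fps R} := Fps (fun n => (n == 1%N)%:R).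

(* The n-th power of the ideal generated by T; it is principal, generated
   by T ^+ n. *)
Definition fps_ideal n : set {fps R} :=
  [set f | exists h : {fps R}, f = fpsT ^+ n * h].

Lemma fps_ideal0 n : fps_ideal n 0.
Proof. by exists 0; rewrite mulr0. Qed.

Lemma fps_idealD n f g : fps_ideal n f -> fps_ideal n g -> fps_ideal n (f + g).
Proof. by move=> [h ->] [k ->]; exists (h + k); rewrite mulrDr. Qed.

Lemma fps_idealS m n f : (m <= n)%N -> fps_ideal n f -> fps_ideal m f.
Proof.
by move=> le_mn [h ->]; exists (fpsT ^+ (n - m) * h); rewrite mulrA -exprD subnKC.
Qed.

(* m-adic topology: the sets f + m^n form a basis of neighbourhoods of f. *)
Definition fps_nbhs f : set_system {fps R} :=
  [set A | exists n, [set g | fps_ideal n (g - f)] `<=` A]%classic.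

HB.instance Definition _ := hasNbhs.Build {fps R} fps_nbhs.

Fact fps_nbhs_filter f : ProperFilter (nbhs f).
Proof.
have nbhs_refl A : nbhs f A -> A f.
  by case=> n; apply; rewrite /= subrr; apply: fps_ideal0.
split; first by move/nbhs_refl.
split=> [|A B [m mA] [n nB]|A B AB [n nA]].
- by exists 0%N.
- exists (maxn m n) => g /= gP; split; [apply: mA|apply: nB] => /=.
    by apply: fps_idealS gP; apply: leq_maxl.
  by apply: fps_idealS gP; apply: leq_maxr.
- by exists n; apply: subset_trans AB.
Qed.

Fact fps_nbhs_singleton f (A : set {fps R}) : nbhs f A -> A f.
Proof. by case=> n; apply; rewrite /= subrr; apply: fps_ideal0. Qed.

Fact fps_nbhs_nbhs f (A : set {fps R}) : nbhs f A -> nbhs f (nbhs^~ A).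
Proof.
case=> n nA; exists n => g /= gP; exists n => h /= hP; apply: nA => /=.
by rewrite -[h](subrK g) -addrA; apply: fps_idealD.
Qed.

HB.instance Definition _ := Nbhs_isNbhsTopological.Build {fps R}
  fps_nbhs_filter fps_nbhs_singleton fps_nbhs_nbhs.

End FpsRing.

Arguments fpsT {R}.
Notation "''T'" := (@fpsT _) : ring_scope.

Definition hder (R S : Type) (theta : R -> {fps S}) (i : nat) (r : R) : S :=
  fpscoef (theta r) i.

Notation "theta ^[ i ]" := (hder theta i)
  (at level 2, left associativity, format "theta ^[ i ]") : ring_scope.

Definition iterative_derivation (R : comNzRingType)
    (theta : {rmorphism R -> {fps R}}) : Prop :=
  (forall r, theta^[0] r = r) /\
  (forall i j r,
     theta^[i] (theta^[j] r) = theta^[(i + j)%N] r *+ 'C((i + j)%N, i)).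

Definition constants (R : comNzRingType) (theta : R -> {fps R}) : {pred R} :=
  fun r => `[< forall i : nat, (1 <= i)%N -> theta^[i] r = 0 >].

(* C(t) as the intersection of all subfields of F containing C and t; that t is
   transcendental over C is not built in. *)
Definition adjoin_pred (F : fieldType) (C : {pred F}) (t : F) : {pred F} :=
  fun x => `[< forall S : {pred F}, GRing.divring_closed S ->
                 {subset C <= S} -> t \in S -> x \in S >].

Section Adjoin.
Variables (F : fieldType) (C : {pred F}) (t : F).

Fact adjoin_divring_closed : GRing.divring_closed (adjoin_pred C t).
Proof.
split=> [|x y /asboolP xP /asboolP yP|x y /asboolP xP /asboolP yP];
  apply/asboolP => S Sdiv CS tS; have [S1 SB SV] := Sdiv.
- by [].
- by apply: SB; [apply: xP|apply: yP].
- by apply: SV; [apply: xP|apply: yP].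
Qed.

HB.instance Definition _ :=
  GRing.isDivringClosed.Build F (adjoin_pred C t) adjoin_divring_closed.

Record adjoin := Adjoin {
  adjoin_val :> F;
  adjoin_valP : adjoin_val \in adjoin_pred C t
}.

HB.instance Definition _ := [isSub for adjoin_val].
HB.instance Definition _ := [Choice of adjoin by <:].
HB.instance Definition _ := [SubChoice_isSubComUnitRing of adjoin by <:].
HB.instance Definition _ := [SubComUnitRing_isSubIntegralDomain of adjoin by <:].
HB.instance Definition _ := [SubIntegralDomain_isSubField of adjoin by <:].

Fact adjoin_genP : t \in adjoin_pred C t.
Proof. by apply/asboolP. Qed.

Definition adjoin_gen : adjoin := Adjoin adjoin_genP.

End Adjoin.

(* The exponent k - n is truncated, which is harmless since the binomial coefficient vanishes when k < n. *)
Definition derivation_by (F : fieldType) (C : {pred F}) (t : F)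
    (theta_t : {rmorphism adjoin C t -> {fps (adjoin C t)}}) : Prop :=
  [/\ iterative_derivation theta_t,
      forall (n : nat) (c x : adjoin C t), adjoin_val c \in C ->
        theta_t^[n] (c * x) = c * theta_t^[n] x
    & forall k n : nat,
        theta_t^[n] (adjoin_gen C t ^+ k)
        = adjoin_gen C t ^+ (k - n) *+ 'C(k, n)].

Definition extends_derivation (F : fieldType) (C : {pred F}) (t : F)
    (theta : F -> {fps F}) (theta_t : adjoin C t -> {fps (adjoin C t)}) : Prop :=
  forall (n : nat) (x : adjoin C t),
    theta^[n] (adjoin_val x) = adjoin_val (theta_t^[n] x).

(* Main.v *)
Require Import Defs.
From HB Require Import structures.
From mathcomp Require Import all_boot all_order all_algebra.
From mathcomp Require Import boolp classical_sets filter topology_structure.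
From mathcomp Require Import zify.

Set Implicit Arguments.
Unset Strict Implicit.
Unset Printing Implicit Defensive.

Import GRing.Theory.
Local Open Scope ring_scope.

(** The change of parameter. Write u(T) = theta(t) - t; it has no constant term
and its linear coefficient theta^[1](t) is invertible, so mu : g |-> g(u) is an
automorphism of F[[T]] and lambda is substitution of the reverse series. For r
in F put g = lambda(theta(r)), i.e. theta(r) = g(u(T)). Iterativity of theta
says that applying theta_S to the coefficients of theta_T(r) gives
theta_{S+T}(r), an identity in F[[S]][[T]]. Set w = u(S+T) - u(S), which is
also what theta_S makes of the coefficients of u(T). Then

- theta_S applied to g(u(T)) is the series (theta_S g) at w, and the
  coefficients theta_S(g_i) are the mu(lambda(theta(g_i)));
- g(u(S+T)) = g(u(S) + w) is the Taylor expansion of g around u(S), a series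
  in w whose coefficients are mu of the Hasse derivatives of g.

Both sides are series in w, and substitution of w is injective because the
coefficient theta_S(theta^[1](t)) of T in w is invertible; since mu is
injective too, comparison of coefficients says exactly that lambda o theta is
iterative. This is iterative_derivation_reparam; the two expansions are
fps_map_subst and fps_translate_subst. Taking F[[S]] as coefficient ring means
that only series in one variable are ever needed.

All identities between power series rest on one principle, contraction_eq0: if
a discrepancy satisfies D(g) = x D(g') for every g, with some other series g'
in place of g, and no nonzero element is divisible by every power of x, then
D = 0. Applied with f = f_0 + T f', it shows that substitution and
translation are multiplicative, and that a ring morphism on F[[T]] sending T to
such an x is determined by its values on constants and on T; applied with
g = g_0 + u g', it shows that mu inverts the recursively defined lambda.

On C(t), the morphism theta' = lambda o theta fixes C, because theta does, and
theta'(t) = t + T. The elements x with every theta'^[n](x) in C(t) form a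
subfield, whence theta' restricts to C(t); and the elements on which theta'
agrees with a given derivation by t form a subfield containing C and t,
whence theta' extends it. *)

(** * Coefficients and the adic topology *)

Section Coefficients.
Variable R : comNzRingType.
Implicit Types (f g h u : {fps R}) (c : R).

Lemma fpscoef0 n : fpscoef (0 : {fps R}) n = 0.
Proof. by []. Qed.

Lemma fpscoefD f g n : fpscoef (f + g) n = fpscoef f n + fpscoef g n.
Proof. by []. Qed.

Lemma fpscoefB f g n : fpscoef (f - g) n = fpscoef f n - fpscoef g n.
Proof. by []. Qed.

Lemma fpscoefZ c f n : fpscoef (c *: f) n = c * fpscoef f n.
Proof. by []. Qed.

Lemma fpscoef1 n : fpscoef (1 : {fps R}) n = (n == 0%N)%:R.
Proof. by []. Qed.

Lemma fpscoefM f g n :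
  fpscoef (f * g) n = \sum_(i < n.+1) fpscoef f i * fpscoef g (n - i)%N.
Proof. by []. Qed.

Lemma fpscoef_sum I (r : seq I) (P : pred I) (E : I -> {fps R}) n :
  fpscoef (\sum_(i <- r | P i) E i) n = \sum_(i <- r | P i) fpscoef (E i) n.
Proof. exact: (big_morph (fun f => fpscoef f n)). Qed.

Lemma fpscoefTM f n :
  fpscoef ('T * f) n = if n is m.+1 then fpscoef f m else 0.
Proof.
rewrite fpscoefM; case: n => [|n]; first by rewrite big_ord1 mul0r.
rewrite 2!big_ord_recl /= mul0r add0r mul1r big1 ?addr0 ?subSS ?subn0 // => i _.
by rewrite mul0r.
Qed.

Lemma fpscoefXM_small k f n : (n < k)%N -> fpscoef ('T ^+ k * f) n = 0.
Proof.
elim: k n => // k IHk [|n] lt_nk; rewrite exprS -mulrA fpscoefTM //.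
exact: IHk.
Qed.

Definition fps_shift f : {fps R} := Fps (fun n => fpscoef f n.+1).

Lemma fpscoef_shift f n : fpscoef (fps_shift f) n = fpscoef f n.+1.
Proof. by []. Qed.

Lemma fps_decomp f : f = (fpscoef f 0)%:A + 'T * fps_shift f.
Proof.
apply: fpsP => n; rewrite fpscoefD fpscoefZ fpscoef1 fpscoefTM.
by case: n => [|n]; rewrite ?mulr1 ?addr0 // mulr0 add0r.
Qed.

Lemma fps_decomp0 u : fpscoef u 0 = 0 -> u = 'T * fps_shift u.
Proof. by move=> u0; rewrite {1}[u]fps_decomp u0 scale0r add0r. Qed.

Lemma fpscoef_expr_small u n k :
  fpscoef u 0 = 0 -> (n < k)%N -> fpscoef (u ^+ k) n = 0.
Proof. by move/fps_decomp0->; rewrite exprMn; apply: fpscoefXM_small. Qed.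

End Coefficients.

(** The ideal generated by x defines a Hausdorff adic topology on A. *)
Definition separating (A : comNzRingType) (x : A) : Prop :=
  forall a : A, (forall N : nat, exists h : A, a = x ^+ N * h) -> a = 0.

Lemma fps_separating (R : comNzRingType) (u : {fps R}) :
  fpscoef u 0 = 0 -> separating u.
Proof.
move/fps_decomp0=> -> f fP; apply: fpsP => n.
have [h ->] := fP n.+1.
by rewrite exprMn -mulrA fpscoefXM_small.
Qed.

(** Here u lies in the ideal (S, T) of R[[S]][[T]], so u ^+ N has no term of
total degree below N. *)
Lemma fps2_separating (R : comNzRingType) (u : {fps {fps R}}) :
  fpscoef (fpscoef u 0) 0 = 0 -> separating u.
Proof.
move=> u00 f fP; apply: fpsP => i; apply: fpsP => j.
have [h ->] := fP (i + j).+1; rewrite !fpscoef0.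
suff small N k l : (k + l < N)%N -> fpscoef (fpscoef (u ^+ N * h) k) l = 0.
  exact: small.
elim: N k l => // N IHN k l lt_klN.
rewrite exprS -mulrA fpscoefM fpscoef_sum big1 // => a _.
rewrite [LHS]fpscoefM big1 // => b _.
have [/andP[/eqP-> /eqP->]|ab_neq0] :=
    boolP ((a == 0 :> nat) && (b == 0 :> nat)).
  by rewrite u00 mul0r.
rewrite IHN ?mulr0 //.
by have := ltn_ord a; have := ltn_ord b; lia.
Qed.

(** * Identities of power series *)

(** Iterating the hypothesis makes D g divisible by every power of x. *)
Lemma contraction_eq0 (X : Type) (A : comNzRingType) (x : A) (D : X -> A)
    (next : X -> X) :
  separating x -> (forall g, D g = x * D (next g)) -> forall g, D g = 0.
Proof.
move=> sep_x Dnext g; apply: sep_x => N; exists (D (iter N next g)).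
elim: N => [|N IHN]; first by rewrite mul1r.
by rewrite IHN Dnext mulrA -exprSr.
Qed.

(** The morphisms agree on polynomials, and both are continuous since they send
multiples of 'T ^+ N to multiples of phi 'T ^+ N. *)
Lemma fps_rmorph_eq (R A : comNzRingType) (phi psi : {rmorphism {fps R} -> A}) :
    separating (phi 'T) -> (forall c : R, phi c%:A = psi c%:A) ->
    phi 'T = psi 'T ->
  phi =1 psi.
Proof.
move=> sep eqC eqT f; apply/eqP; rewrite -subr_eq0; apply/eqP; move: f.
apply: (contraction_eq0 (next := @fps_shift R)) sep _ => f.
rewrite {1 2}[f]fps_decomp !rmorphD !rmorphM eqC -eqT /=.
by rewrite opprD addrACA subrr add0r mulrBr.
Qed.

(** * Substitution *)

(** The sum stops at n because u ^+ i starts in degree i; the proof u0 is an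
argument so that the map carries its ring morphism structure. *)
Definition fps_subst (R : comNzRingType) (u : {fps R})
    (u0 : fpscoef u 0 = 0) (f : {fps R}) : {fps R} :=
  Fps (fun n => \sum_(i < n.+1) fpscoef f i * fpscoef (u ^+ i) n).

Section Substitution.
Variables (R : comNzRingType) (u : {fps R}) (u0 : fpscoef u 0 = 0).
Implicit Types f g h : {fps R}.

Lemma fpscoef_subst f n :
  fpscoef (fps_subst u0 f) n = \sum_(i < n.+1) fpscoef f i * fpscoef (u ^+ i) n.
Proof. by []. Qed.

Lemma fps_subst_linear : linear (fps_subst u0).
Proof.
move=> a f g; apply: fpsP => n; rewrite fpscoefD fpscoefZ /=.
rewrite mulr_sumr -big_split; apply: eq_bigr => i _ /=.
by rewrite mulrDl mulrA.
Qed.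

HB.instance Definition _ :=
  GRing.isLinear.Build R {fps R} {fps R} *:%R (fps_subst u0) fps_subst_linear.

Lemma fps_subst1 : fps_subst u0 1 = 1.
Proof.
apply: fpsP => n /=; rewrite big_ord_recl mul1r big1 ?addr0 // => i _.
by rewrite mul0r.
Qed.

Lemma fps_substZ a f : fps_subst u0 (a *: f) = a *: fps_subst u0 f.
Proof. exact: linearZ. Qed.

Lemma fps_substC a : fps_subst u0 a%:A = a%:A.
Proof. by rewrite fps_substZ fps_subst1. Qed.

Lemma fps_substTM f : fps_subst u0 ('T * f) = u * fps_subst u0 f.
Proof.
apply: fpsP => n; rewrite fpscoef_subst [RHS]fpscoefM.
rewrite big_ord_recl fpscoefTM mul0r add0r.
(* The last term vanishes since u ^+ n.+1 starts in degree n.+1. *)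
transitivity (\sum_(i < n.+1) fpscoef f i * fpscoef (u * u ^+ i) n).
  rewrite [RHS]big_ord_recr -exprS (fpscoef_expr_small u0) // mulr0.
  apply: etrans (esym (addr0 _)).
  by apply: eq_bigr => i _; rewrite lift0 fpscoefTM -exprS.
transitivity (\sum_(i < n.+1) \sum_(j < n.+1)
    fpscoef f i * (fpscoef u j * fpscoef (u ^+ i) (n - j))).
  by apply: eq_bigr => i _; rewrite fpscoefM mulr_sumr.
rewrite exchange_big /=; apply: eq_bigr => j _.
have le_nj : ((n - j).+1 <= n.+1)%N by rewrite ltnS leq_subr.
rewrite (big_ord_widen _ (fun i => fpscoef f i * fpscoef (u ^+ i) (n - j)) le_nj).
rewrite mulr_sumr [RHS]big_mkcond /=; apply: eq_bigr => i _.
case: ltnP => [_|lt_i]; first by rewrite mulrCA.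
by rewrite (fpscoef_expr_small u0 lt_i) !mulr0.
Qed.

Lemma fps_subst_decomp f :
  fps_subst u0 f = (fpscoef f 0)%:A + u * fps_subst u0 (fps_shift f).
Proof. by rewrite {1}[f]fps_decomp linearD /= fps_substC fps_substTM. Qed.

(** For fixed g the defect of multiplicativity vanishes on constants and is
multiplied by u when f is multiplied by T. *)
Lemma fps_subst_mul f g : fps_subst u0 (f * g) = fps_subst u0 f * fps_subst u0 g.
Proof.
apply/eqP; rewrite -subr_eq0; apply/eqP; move: f.
apply: (contraction_eq0 (next := @fps_shift R)) (fps_separating u0) _ => f.
rewrite {1 2}[f]fps_decomp mulrDl -mulrA !linearD /= !fps_substTM.
rewrite -scalerAl mul1r fps_substZ fps_substC mulrDl -scalerAl mul1r.
by rewrite opprD addrACA subrr add0r mulrBr mulrA.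
Qed.

HB.instance Definition _ :=
  GRing.isMonoidMorphism.Build {fps R} {fps R} (fps_subst u0)
    (fps_subst1, fps_subst_mul).

Lemma fps_substT : fps_subst u0 'T = u.
Proof. by rewrite -['T]mulr1 fps_substTM fps_subst1 mulr1. Qed.

Lemma fpscoef_subst0 f : fpscoef (fps_subst u0 f) 0 = fpscoef f 0.
Proof. by rewrite /= big_ord1 expr0 mulr1. Qed.

End Substitution.

Section Reversion.
Variable R : comNzRingType.
Implicit Types (f g h : {fps R}) (a b : R).

(** The inverse is the geometric series evaluated at 1 - b f, which has no
constant term. *)
Lemma fps_inv_exists f b : fpscoef f 0 * b = 1 -> exists g, f * g = 1.
Proof.
move=> f0b; have z0 : fpscoef (1 - b *: f) 0 = 0.
  by rewrite fpscoefB fpscoefZ mulrC f0b fpscoef1 subrr.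
pose geom : {fps R} := Fps (fun=> 1).
have geomE : (1 - 'T) * geom = 1.
  apply: fpsP => n; rewrite mulrBl mul1r fpscoefB fpscoefTM fpscoef1.
  by case: n => [|n]; rewrite ?subr0 ?subrr.
exists (b *: fps_subst z0 geom).
rewrite -scalerAr scalerAl -[RHS](fps_subst1 z0).
apply: etrans (congr1 (fps_subst z0) geomE); rewrite fps_subst_mul.
by rewrite rmorphB /= fps_subst1 fps_substT subKr.
Qed.

Variables (u : {fps R}) (u0 : fpscoef u 0 = 0).
Variables (b : R) (u1b : fpscoef u 1 * b = 1).

Let unit_part_inv : exists w, fps_shift u * w = 1.
Proof. exact: (@fps_inv_exists (fps_shift u) b u1b). Qed.

(** Division by u with remainder, see [fps_nextE]: the quotient of g - g_0. *)
Definition fps_next g : {fps R} := sval (cid unit_part_inv) * fps_shift g.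

Lemma fps_nextE g : g = (fpscoef g 0)%:A + u * fps_next g.
Proof.
rewrite {1}(fps_decomp0 u0) /fps_next; case: (cid _) => w /= uw.
by rewrite -mulrA (mulrA _ w) uw mul1r -fps_decomp.
Qed.

(** The expansion of g in powers of u: its coefficients are the successive
remainders in the repeated division by u. *)
Definition fps_reversion g : {fps R} :=
  Fps (fun n => fpscoef (iter n fps_next g) 0).

Lemma fps_reversionK : cancel fps_reversion (fps_subst u0).
Proof.
move=> g; apply/eqP; rewrite -subr_eq0; apply/eqP; move: g.
apply: (contraction_eq0 (next := fps_next)) (fps_separating u0) _ => g.
have -> : fps_reversion g = (fpscoef g 0)%:A + 'T * fps_reversion (fps_next g).
  rewrite [LHS]fps_decomp; congr (_ + 'T * _).
  by apply: fpsP => n; rewrite /= -iterSr.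
rewrite [X in _ - X]fps_nextE linearD /= fps_substC fps_substTM.
by rewrite opprD addrACA subrr add0r mulrBr.
Qed.

Lemma fps_substK : cancel (fps_subst u0) fps_reversion.
Proof.
have next_subst f :
    fps_next (fps_subst u0 f) = fps_subst u0 (fps_shift f).
  rewrite /fps_next; case: (cid _) => w uw; rewrite [sval _]/=.
  have -> : fps_shift (fps_subst u0 f)
      = fps_shift u * fps_subst u0 (fps_shift f).
    apply: fpsP => n; rewrite fpscoef_shift fps_subst_decomp.
    have -> h : u * h = 'T * (fps_shift u * h) by rewrite mulrA -fps_decomp0.
    by rewrite fpscoefD fpscoefZ fpscoef1 mulr0 add0r fpscoefTM.
  by rewrite mulrA (mulrC w) uw mul1r.
move=> f; apply: fpsP => n /=.
have -> : iter n fps_next (fps_subst u0 f)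
    = fps_subst u0 (iter n (@fps_shift R) f).
  by elim: n => //= n ->; rewrite next_subst.
rewrite fpscoef_subst0; elim: n f => // n IHn f.
by rewrite iterSr IHn.
Qed.

End Reversion.

Lemma fps_subst_continuous (R : comNzRingType) (u : {fps R})
  (u0 : fpscoef u 0 = 0) : continuous (fps_subst u0).
Proof.
move=> f A [n nA]; exists n => g /= [h gf]; apply: nA => /=.
exists (fps_shift u ^+ n * fps_subst u0 h).
by rewrite -rmorphB gf rmorphM rmorphXn /= fps_substT mulrA -exprMn -fps_decomp0.
Qed.

(** * Morphisms on coefficients and translation *)

Definition fps_map (R S : Type) (phi : R -> S) (f : {fps R}) : {fps S} :=
  Fps (fun n => phi (fpscoef f n)).

Lemma fps_map_inj (R S : Type) (phi : R -> S) :
  injective phi -> injective (fps_map phi).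
Proof.
move=> phi_inj f g fg; apply: fpsP => n.
by have /phi_inj := congr1 (fun h => fpscoef h n) fg.
Qed.

Section Map.
Variables (R S : comNzRingType) (phi : {rmorphism R -> S}).

Lemma fps_map_zmod_morphism : zmod_morphism (fps_map phi).
Proof. by move=> f g; apply: fpsP => n; rewrite fpscoefB /= rmorphB. Qed.

HB.instance Definition _ :=
  GRing.isZmodMorphism.Build {fps R} {fps S} (fps_map phi) fps_map_zmod_morphism.

Lemma fps_map_monoid_morphism : GRing.monoid_morphism (fps_map phi).
Proof.
split=> [|f g]; apply: fpsP => n; first by rewrite /= rmorph_nat.
by rewrite fpscoefM /= rmorph_sum; apply: eq_bigr => i _; rewrite rmorphM.
Qed.

HB.instance Definition _ :=
  GRing.isMonoidMorphism.Build {fps R} {fps S} (fps_map phi)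
    fps_map_monoid_morphism.

Lemma fps_mapT : fps_map phi 'T = 'T.
Proof. by apply: fpsP => n; rewrite /= rmorph_nat. Qed.

Lemma fps_mapC c : fps_map phi c%:A = (phi c)%:A.
Proof. by apply: fpsP => n; rewrite /= rmorphM rmorph_nat. Qed.

End Map.

(** Both composites send 'T to the image of u and constants to their images. *)
Lemma fps_map_subst (R S : comNzRingType) (phi : {rmorphism R -> S})
    (u : {fps R}) (u0 : fpscoef u 0 = 0)
    (w0 : fpscoef (fps_map phi u) 0 = 0) :
  fps_map phi \o fps_subst u0 =1 fps_subst w0 \o fps_map phi.
Proof.
apply: fps_rmorph_eq => [|c|] /=; rewrite ?fps_substT //.
- exact: fps_separating.
- by rewrite fps_mapC !fps_substC fps_mapC.
- by rewrite fps_mapT fps_substT.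
Qed.

Section Translation.
Variable R : comNzRingType.
Implicit Types (f g : {fps R}) (c : R).

(** f(S + T), as a series in T whose coefficient of T^i is the i-th Hasse
derivative of f, written in S. *)
Definition fps_translate f : {fps {fps R}} :=
  Fps (fun i => Fps (fun j => fpscoef f (j + i) *+ 'C(j + i, j))).

Lemma fpscoef_translate f i j :
  fpscoef (fpscoef (fps_translate f) i) j = fpscoef f (j + i) *+ 'C(j + i, j).
Proof. by []. Qed.

Lemma fps_translate_zmod_morphism : zmod_morphism fps_translate.
Proof.
move=> f g; apply: fpsP => i; apply: fpsP => j.
by rewrite /= -mulrnBl.
Qed.

HB.instance Definition _ :=
  GRing.isZmodMorphism.Build {fps R} {fps {fps R}} fps_translate
    fps_translate_zmod_morphism.

(* 'T%:A is the inner variable S, 'T the outer one. *)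
Let ST : {fps {fps R}} := ('T : {fps R})%:A + 'T.

Lemma fps_translateZ c f : fps_translate (c *: f) = c%:A *: fps_translate f.
Proof.
apply: fpsP => i; apply: fpsP => j.
by rewrite fpscoefZ -scalerAl mul1r !fpscoefZ /= -mulrnAr.
Qed.

Lemma fps_translate1 : fps_translate 1 = 1.
Proof.
apply: fpsP => i; apply: fpsP => j; rewrite /= addn_eq0.
case: i => [|i]; case: j => [|j] //=; by rewrite mul0rn.
Qed.

(** Pascal's rule. *)
Lemma fps_translateTM f : fps_translate ('T * f) = ST * fps_translate f.
Proof.
apply: fpsP => i; apply: fpsP => j.
rewrite mulrDl -scalerAl mul1r !fpscoefD fpscoefZ !fpscoefTM.
rewrite fpscoef_translate fpscoefTM.
case: i => [|i]; case: j => [|j]; rewrite ?fpscoef_translate.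
- by rewrite mul0rn addr0.
- by rewrite addr0 !addn0 !binn.
- by rewrite add0r !bin0.
- by rewrite addSn binS addnS mulrnDr addSn addrC.
Qed.

Lemma fps_translateT : fps_translate 'T = ST.
Proof. by rewrite -['T]mulr1 fps_translateTM fps_translate1 mulr1. Qed.

Lemma ST_separating : separating ST.
Proof.
apply: fps2_separating.
by rewrite /ST /= big_ord1 mul0r addr0.
Qed.

Lemma fps_translate_mul f g :
  fps_translate (f * g) = fps_translate f * fps_translate g.
Proof.
apply/eqP; rewrite -subr_eq0; apply/eqP; move: f.
have [x translateTM sep_x] : exists2 x,
    forall h, fps_translate ('T * h) = x * fps_translate h & separating x.
  by exists ST; [exact: fps_translateTM | exact: ST_separating].
apply: (contraction_eq0 (next := @fps_shift R)) sep_x _ => f.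
rewrite {1 2}[f]fps_decomp mulrDl -mulrA !raddfD /= !translateTM.
rewrite -scalerAl mul1r !fps_translateZ fps_translate1 /= mulrDl -scalerAl mul1r.
by rewrite opprD addrACA subrr add0r mulrBr mulrA.
Qed.

HB.instance Definition _ :=
  GRing.isMonoidMorphism.Build {fps R} {fps {fps R}} fps_translate
    (fps_translate1, fps_translate_mul).

Lemma fps_translateC c : fps_translate c%:A = c%:A%:A.
Proof. by rewrite fps_translateZ fps_translate1. Qed.

End Translation.

(** Taylor's formula g(u(S+T)) = g(u(S) + w) with w = u(S+T) - u(S): both sides
are ring morphisms in g that send T to u(S+T). *)
Lemma fps_translate_subst (R : comNzRingType) (u : {fps R})
    (u0 : fpscoef u 0 = 0)
    (w0 : fpscoef (fps_translate u - u%:A) 0 = 0) :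
  @fps_translate R \o fps_subst u0
    =1 fps_subst w0 \o (fps_map (fps_subst u0) \o @fps_translate R).
Proof.
apply: fps_rmorph_eq => [|c|] /=; rewrite ?fps_substT.
- apply: fps2_separating.
  by rewrite /= add0n bin0 u0 mul0rn.
- by rewrite fps_substC !fps_translateC fps_mapC /= !fps_substC.
- rewrite fps_translateT rmorphD /= fps_mapC fps_mapT linearD /=.
  by rewrite fps_substC !fps_substT addrC subrK.
Qed.

(** * Change of parameter *)

(** Iterativity is the additive group law theta_S theta_T = theta_{S+T}. *)
Lemma iterative_derivationP (R : comNzRingType) (theta : {rmorphism R -> {fps R}}) :
  (forall r, theta^[0] r = r) ->
  iterative_derivation theta <->
  (forall r, fps_map theta (theta r) = fps_translate (theta r)).
Proof.
move=> theta0; split=> [[_ iter_theta] r|thetaE].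
  by apply: fpsP => i; apply: fpsP => j; apply: iter_theta.
split=> // i j r.
by have := congr1 (fun f => fpscoef (fpscoef f j) i) (thetaE r).
Qed.

(** Equal series may be exchanged even though the type of u0 mentions u. *)
Lemma fps_subst_eq (R : comNzRingType) (u v : {fps R}) (u0 : fpscoef u 0 = 0)
  (v0 : fpscoef v 0 = 0) : u = v -> fps_subst u0 =1 fps_subst v0.
Proof. by move=> uv f; rewrite /fps_subst uv. Qed.

(** With g = lambda(theta(r)), both theta_S theta_T(r) and theta_{S+T}(r) are
substitutions of w = u(S+T) - u(S), and w has invertible coefficient of T. *)
Lemma iterative_derivation_reparam (R : comNzRingType)
    (theta : {rmorphism R -> {fps R}}) (t b : R)
    (u0 : fpscoef (theta t - t%:A) 0 = 0)
    (lambda : {rmorphism {fps R} -> {fps R}}) :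
  theta^[1] t * b = 1 -> cancel lambda (fps_subst u0) ->
  iterative_derivation theta -> iterative_derivation (lambda \o theta).
Proof.
set u := theta t - t%:A in u0 * => theta1tb lambdaK iter_theta.
have [theta0 _] := iter_theta.
move/(iterative_derivationP theta0): iter_theta => thetaE.
have theta'0 r : (lambda \o theta)^[0] r = r.
  by rewrite /hder /= -(fpscoef_subst0 u0) lambdaK; apply: theta0.
apply/(iterative_derivationP theta'0) => r.
have u1b : fpscoef u 1 * b = 1 by rewrite fpscoefB fpscoefZ mulr0 subr0.
have w0 : fpscoef (fps_map theta u) 0 = 0 by rewrite /= [X in theta X]u0 rmorph0.
have w1b : fpscoef (fps_map theta u) 1 * theta b = 1 by rewrite -rmorphM u1b rmorph1.
(* theta_S(u(T)) = theta_{S+T}(t) - theta_S(t). *)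
have wE : fps_map theta u = fps_translate u - u%:A.
  rewrite /u !rmorphB /= fps_mapC thetaE fps_translateC scalerBl opprB.
  by rewrite addrA subrK.
have w0' : fpscoef (fps_translate u - u%:A) 0 = 0 by rewrite -wE.
have subst_inj := can_inj (fps_substK u0 u1b).
apply: (fps_map_inj subst_inj); apply: (can_inj (fps_substK w0 w1b)).
set g := (lambda \o theta) r; have gE : fps_subst u0 g = theta r by apply: lambdaK.
transitivity (fps_map theta (fps_subst u0 g)).
  have -> : fps_map (fps_subst u0) (fps_map (lambda \o theta) g) = fps_map theta g.
    by apply: fpsP => n; apply: lambdaK.
  by rewrite [RHS](fps_map_subst u0 w0).
rewrite gE thetaE -gE [LHS](fps_translate_subst u0 w0').
by rewrite (fps_subst_eq w0 w0' wE).
Qed.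

(** * The field C(t) *)

Lemma rmorph_eq_div (K : fieldType) (A : comNzRingType) (f g : {rmorphism K -> A})
  (x y : K) : f x = g x -> f y = g y -> f (x / y) = g (x / y).
Proof.
move=> fgx fgy; have [->|y_neq0] := eqVneq y 0; first by rewrite invr0 mulr0 !rmorph0.
have -> : f (x / y) = g (x / y) * g y * f y^-1.
  by rewrite -rmorphM divfK // -fgx -rmorphM.
by rewrite -mulrA -fgy -rmorphM mulfV // rmorph1 mulr1.
Qed.

Lemma sub_adjoin (F : fieldType) (C : {pred F}) (t c : F) :
  c \in C -> c \in adjoin_pred C t.
Proof. by move=> cC; apply/asboolP => S _ CS _; apply: CS. Qed.

Section Adjunction.
Variables (F : fieldType) (C : {pred F}) (t : F).
Variable phi : {rmorphism F -> {fps F}}.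
Hypothesis phi_iter : iterative_derivation phi.
Hypothesis phiC : forall c, c \in C -> phi c = c%:A.
Hypothesis phit : phi t = t%:A + 'T.

(** The elements with this property form a subfield containing C and t. For a
quotient y / z, the coefficients of phi (y / z) are obtained recursively from
phi y = phi (y / z) * phi z, whose constant coefficient z is invertible. *)
Lemma adjoin_stable n x : x \in adjoin_pred C t -> phi^[n] x \in adjoin_pred C t.
Proof.
pose S : {pred F} := fun x => `[< forall n, phi^[n] x \in adjoin_pred C t >].
move=> /asboolP/(_ S) xS; move: n; apply/asboolP; apply: xS => [|c cC|].
- split=> [|y z /asboolP yS /asboolP zS|y z /asboolP yS /asboolP zS].
  + by apply/asboolP => n; rewrite /hder rmorph1 fpscoef1 rpred_nat.
  + by apply/asboolP => n; rewrite /hder rmorphB rpredB //; [apply: yS|apply: zS].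
  have [->|z_neq0] := eqVneq z 0.
    by apply/asboolP => n; rewrite /hder invr0 mulr0 rmorph0 rpred0.
  apply/asboolP => n; have [m] := ubnP n; elim: m n => // m IHm n /ltnSE le_nm.
  have prodP i : (i < n)%N ->
      phi^[i] (y / z) * phi^[n - i] z \in adjoin_pred C t.
    by move=> lt_in; rewrite rpredM //; apply: IHm; apply: leq_trans le_nm.
  have: phi^[n] y = phi^[n] (y / z * z) by rewrite divfK.
  rewrite /hder rmorphM fpscoefM big_ord_recr subnn.
  rewrite -/(hder phi 0 z) (proj1 phi_iter) => /esym/(canRL (addKr _)).
  move/(canRL (mulfK z_neq0))->.
  rewrite rpred_div ?rpredD ?rpredN ?rpred_sum //; last 2 first.
  + exact: yS.
  + by rewrite -[z](proj1 phi_iter); apply: zS.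
  by move=> i _; apply: prodP (ltn_ord i).
- apply/asboolP => n; rewrite /hder phiC // fpscoefZ fpscoef1 rpredM ?rpred_nat //.
  exact: sub_adjoin.
- apply/asboolP => n; rewrite /hder phit fpscoefD fpscoefZ fpscoef1.
  by rewrite rpredD ?rpredM ?rpred_nat // adjoin_genP.
Qed.

Definition adjoin_restr (x : adjoin C t) : {fps (adjoin C t)} :=
  Fps (fun n => Adjoin (adjoin_stable n (adjoin_valP x))).

Local Notation vals := (fps_map (val : adjoin C t -> F)).

Lemma adjoin_restrE x : vals (adjoin_restr x) = phi (val x).
Proof. exact: fpsP. Qed.

Lemma vals_inj : injective vals.
Proof. exact: fps_map_inj val_inj. Qed.

Lemma adjoin_restr_zmod_morphism : zmod_morphism adjoin_restr.
Proof.
by move=> x y; apply: vals_inj; rewrite !(adjoin_restrE, rmorphB).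
Qed.

HB.instance Definition _ := GRing.isZmodMorphism.Build
  (adjoin C t) {fps (adjoin C t)} adjoin_restr adjoin_restr_zmod_morphism.

Lemma adjoin_restr_monoid_morphism : GRing.monoid_morphism adjoin_restr.
Proof.
split=> [|x y]; apply: vals_inj.
  by rewrite adjoin_restrE !rmorph1.
by rewrite !(adjoin_restrE, rmorphM).
Qed.

HB.instance Definition _ := GRing.isMonoidMorphism.Build
  (adjoin C t) {fps (adjoin C t)} adjoin_restr adjoin_restr_monoid_morphism.

Lemma hder_exprt k n : phi^[n] (t ^+ k) = t ^+ (k - n) *+ 'C(k, n).
Proof.
rewrite /hder; elim: k n => [|k IHk] n.
  rewrite expr0 rmorph1 fpscoef1 bin0n.
  by case: n.
rewrite exprS rmorphM phit mulrDl -scalerAl mul1r fpscoefD fpscoefZ fpscoefTM.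
case: n => [|n]; first by rewrite IHk addr0 !subn0 !bin0 exprS.
rewrite !IHk binS mulrnDr subSS; congr (_ + _).
case: (ltnP n k) => [lt_nk|le_kn]; last by rewrite bin_small // !mulr0n mulr0.
by rewrite mulrnAr -exprS -subSn // subSS.
Qed.

Lemma derivation_by_adjoin_restr : derivation_by adjoin_restr.
Proof.
split=> [|n c x cC|k n].
- split=> [x|i j x]; apply: val_inj; first exact: (proj1 phi_iter).
  by rewrite rmorphMn; apply: (proj2 phi_iter).
- apply: val_inj; rewrite rmorphM /= /hder /=.
  by rewrite rmorphM phiC // -scalerAl mul1r.
- apply: val_inj; rewrite rmorphMn rmorphXn -hder_exprt /=.
  by congr (hder phi n _); apply: (rmorphXn (val : adjoin C t -> F)).
Qed.

(** The elements of C(t) where the two morphisms to F[[T]] agree form a subfield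
of F, and a derivation by t has prescribed values on C and at t. *)
Lemma derivation_by_extends
    (theta_t : {rmorphism adjoin C t -> {fps (adjoin C t)}}) :
  derivation_by theta_t -> extends_derivation phi theta_t.
Proof.
move=> [_ linC powt].
pose f : {rmorphism adjoin C t -> {fps F}} := phi \o (val : adjoin C t -> F).
pose g : {rmorphism adjoin C t -> {fps F}} :=
  fps_map (val : adjoin C t -> F) \o theta_t.
pose S : {pred F} := fun x => `[< exists2 y : adjoin C t, val y = x & f y = g y >].
suff fg : f =1 g.
  by move=> n x; have := congr1 (fun h => fpscoef h n) (fg x).
move=> x; have /asboolP/(_ S) xS := adjoin_valP x.
suff /asboolP[y /val_inj <- //] : val x \in S.
apply: xS => [|c cC|].
- split=> [|_ _ /asboolP[y <- fgy] /asboolP[z <- fgz]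
           |_ _ /asboolP[y <- fgy] /asboolP[z <- fgz]]; apply/asboolP.
  + by exists 1; rewrite ?rmorph1.
  + by exists (y - z); rewrite !rmorphB // fgy fgz.
  + by exists (y / z); [rewrite fmorph_div | apply: rmorph_eq_div].
- have cCt : c \in adjoin_pred C t by apply: sub_adjoin.
  apply/asboolP; exists (Adjoin cCt) => //.
  apply: fpsP => n; rewrite [LHS](congr1 (fun h => fpscoef h n) (phiC cC)).
  transitivity (val (theta_t^[n] (Adjoin cCt * 1))); last by rewrite mulr1.
  by rewrite linC // /hder rmorph1 rmorphM fpscoefZ rmorph_nat.
- apply/asboolP; exists (adjoin_gen C t) => //.
  apply: fpsP => n; transitivity (val (theta_t^[n] (adjoin_gen C t ^+ 1))) => //.
  by rewrite powt rmorphMn rmorphXn -(hder_exprt 1) expr1.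
Qed.

End Adjunction.

Theorem proposition3p7 (F : fieldType) (theta : {rmorphism F -> {fps F}}) (t : F)
  (theta_iter : iterative_derivation theta)
  (theta1_neq0 : exists x : F, theta^[1] x != 0)
  (theta1t_neq0 : theta^[1] t != 0) :
  let C := constants theta in
  exists mu lambda : {lrmorphism {fps F} -> {fps F}},
    [/\ [/\ continuous mu, mu 'T = theta t - t%:A,
            cancel mu lambda & cancel lambda mu],
        (forall nu : {lrmorphism {fps F} -> {fps F}},
           continuous nu -> nu 'T = theta t - t%:A -> nu =1 mu),
        iterative_derivation (lambda \o theta),
        (exists theta_t : {rmorphism adjoin C t -> {fps (adjoin C t)}},
           derivation_by theta_t)
      & (forall theta_t : {rmorphism adjoin C t -> {fps (adjoin C t)}},
           derivation_by theta_t ->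
           extends_derivation (lambda \o theta) theta_t)
        /\ (lambda \o theta) t = t%:A + 'T].
Proof.
move=> C; have [theta0 _] := theta_iter.
have u0 : fpscoef (theta t - t%:A) 0 = 0.
  by rewrite fpscoefB fpscoefZ mulr1 [X in X - _]theta0 subrr.
have u1V : fpscoef (theta t - t%:A) 1 / theta^[1] t = 1.
  by rewrite fpscoefB fpscoefZ mulr0 subr0 mulfV.
pose mu : {lrmorphism {fps F} -> {fps F}} := fps_subst u0.
have muK : cancel mu (fps_reversion u1V) := fps_substK u0 u1V.
have lambdaK : cancel (fps_reversion u1V) mu := fps_reversionK u0 u1V.
pose lambdaL := GRing.isLinear.Build F {fps F} {fps F} *:%R (fps_reversion u1V)
  (can2_linear muK lambdaK).
pose lambdaM := GRing.isMonoidMorphism.Build {fps F} {fps F} (fps_reversion u1V)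
  (can2_monoid_morphism muK lambdaK).
pose lambda : {lrmorphism {fps F} -> {fps F}} :=
  HB.pack (fps_reversion u1V) lambdaL lambdaM.
have iter_theta' : iterative_derivation (lambda \o theta).
  exact: (iterative_derivation_reparam (lambda := lambda)
            (mulfV theta1t_neq0) lambdaK theta_iter).
have theta'C c : c \in C -> (lambda \o theta) c = c%:A.
  move=> /asboolP cP; apply: (canLR muK); rewrite linearZ rmorph1.
  apply: fpsP => n; rewrite fpscoefZ fpscoef1.
  by case: n => [|n]; [rewrite mulr1 [LHS]theta0 | rewrite mulr0 [LHS]cP].
have theta't : (lambda \o theta) t = t%:A + 'T.
  apply: (canLR muK); rewrite linearD linearZ rmorph1 /= fps_substT.
  by rewrite addrC subrK.
exists mu, lambda; split.
- by split=> //; [exact: fps_subst_continuous | exact: fps_substT].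
- move=> nu _ nuT; apply: fps_rmorph_eq => [|c|].
  + by rewrite /= nuT; apply: fps_separating.
  + by rewrite /= !linearZ !rmorph1.
  + by rewrite /= nuT fps_substT.
- exact: iter_theta'.
- exists (adjoin_restr iter_theta' theta'C theta't).
  exact: derivation_by_adjoin_restr.
- by split=> // theta_t; apply: derivation_by_extends.
Qed.
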